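(* Let $N$ be a Nijenhuis operator on a left-symmetric algebroid $(A,\cdot_A,a_A)$. Then a deformation of $(A,\cdot_A,a_A)$ can be obtained by putting $$\omega(x,y)=\mathrm{d}_{def}N(x,y),\qquad x,y\in\Gamma(A),$$ where $\mathrm{d}_{def}N(x,y)=x\cdot_A N(y)+N(x)\cdot_A y-N(x\cdot_A y)$. Furthermore, this deformation is trivial.
   Context: All vector bundles are over the same smooth manifold $M$; bundle maps cover the identity of $M$ and are $C^\infty(M)$-linear on sections. A left-symmetric algebra is a vector space with a bilinear product $\cdot$ such that $(x\cdot y)\cdot z-x\cdot(y\cdot z)=(y\cdot x)\cdot z-y\cdot(x\cdot z)$. A left-symmetric algebroid $(A,\cdot_A,a_A)$ is a vector bundle $A\to M$ with a left-symmetric algebra structure $\cdot_A$ on the (real vector) space of sections $\Gamma(A)$ and a bundle map $a_A:A\to TM$ (the anchor) such that $x\cdot_A(fy)=f(x\cdot_A y)+a_A(x)(f)y$ and $(fx)\cdot_A y=f(x\cdot_A y)$ for all $f\in C^\infty(M)$, $x,y\in\Gamma(A)$. A homomorphism $\varphi:(A_1,\cdot_1,a_1)\to(A_2,\cdot_2,a_2)$ of left-symmetric algebroids is a bundle map with $\varphi(x\cdot_1y)=\varphi(x)\cdot_2\varphi(y)$ for all $x,y\in\Gamma(A_1)$ and $a_2\circ\varphi=a_1$; an isomorphism is an invertible homomorphism. A Nijenhuis operator on $(A,\cdot_A,a_A)$ is a bundle map $N:A\to A$ such that $N(x)\cdot_A N(y)-N(x\cdot_A N(y))-N(N(x)\cdot_A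 y)+N^2(x\cdot_A y)=0$ for all $x,y\in\Gamma(A)$. $\mathrm{Der}^2(A)$ is the space of $\mathbb{R}$-bilinear maps $\omega:\Gamma(A)\times\Gamma(A)\to\Gamma(A)$ with $\omega(fx,y)=f\omega(x,y)$ and $\omega(x,fy)=f\omega(x,y)+\sigma_\omega(x)(f)y$ for a bundle map $\sigma_\omega:A\to TM$, called the symbol of $\omega$. (For a bundle map $N:A\to A$, $\mathrm{d}_{def}N$ lies in $\mathrm{Der}^2(A)$ and has symbol $a_A\circ N$.) For $\omega\in\mathrm{Der}^2(A)$ put $x\cdot_ty=x\cdot_Ay+t\,\omega(x,y)$ and $a_t=a_A+t\,\sigma_\omega$. If $A_t=(A,\cdot_t,a_t)$ is a left-symmetric algebroid for all $t\in I$, where $I$ denotes the range of the parameter $t$, then $\omega$ is said to generate a ($1$-parameter infinitesimal) deformation $A_t$ of $(A,\cdot_A,a_A)$. A deformation $A_t$ is said to be trivial if there exists a family of left-symmetric algebroid isomorphisms $\mathrm{Id}+tN:A_t\to A$, with $N:A\to A$ a bundle map.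
   Formalization: Triviality is asserted only for parameter ranges I on which Id+tN is fibrewise bijective for every t in I; without this it fails (M a point, A=R with its usual product, N=Id, t=-1 gives the zero product). *)

(* Defs.v *)
From HB Require Import structures.
From mathcomp Require Import all_boot all_order all_algebra.
From mathcomp Require Import all_classical all_reals all_analysis.
Set Implicit Arguments.
Unset Strict Implicit.
Unset Printing Implicit Defensive.
Import Order.TTheory GRing.Theory Num.Theory.
Import numFieldNormedType.Exports.
Local Open Scope classical_set_scope.
Local Open Scope ring_scope.

Section SmoothEuclidean.
Variables (R : realType) (n : nat).
Implicit Types (U V : set 'rV[R]_n) (f g : 'rV[R]_n -> R) (k : nat).

(* C^k on the open set [U], through iterated partial derivatives; [f] is total
   but only its values on [U] matter. *)
Fixpoint Ck U k f : Prop :=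
  (forall x, U x -> {for x, continuous f}) /\
  if k is k'.+1 then
    forall i, (forall x, U x -> derivable f x (delta_mx 0 i)) /\
              Ck U k' (fun x => 'D_(delta_mx 0 i) f x)
  else True.

Definition smooth U f := forall k, Ck U k f.

Lemma Ck_continuous U k f : Ck U k f -> forall x, U x -> {for x, continuous f}.
Proof. by case: k => [|k] []. Qed.

Lemma CkW U k f : Ck U k.+1 f -> Ck U k f.
Proof.
elim: k f => [|k IH] f [fc fd]; first by split.
by split=> // i; have [? ?] := fd i; split=> //; exact: IH.
Qed.

Lemma Ck_local U k f :
  (forall x, U x -> exists2 V, V x & Ck V k f) -> Ck U k f.
Proof.
elim: k f => [|k IH] f H.
  by split=> // x Ux; have [V Vx [+ _]] := H x Ux; apply.
split=> [x Ux|i].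
  by have [V Vx [+ _]] := H x Ux; apply.
split=> [x Ux|].
  by have [V Vx [_ /(_ i)[+ _]]] := H x Ux; apply.
apply: IH => x Ux; have [V Vx [_ /(_ i)[_ Hd]]] := H x Ux.
by exists V.
Qed.

Lemma sub_Ck U V k f : V `<=` U -> Ck U k f -> Ck V k f.
Proof. by move=> VU Uf; apply: Ck_local => x /VU Ux; exists U. Qed.

Lemma eq_Ck U k f g : open U -> (forall x, U x -> f x = g x) ->
  Ck U k f -> Ck U k g.
Proof.
move=> oU; elim: k f g => [|k IH] f g fg.
  move=> [fc _]; split=> // x Ux.
  have nfg : \forall y \near x, f y = g y.
    by apply: filterS (open_nbhs_nbhs (conj oU Ux)) => y; exact: fg.
  have := fc x Ux; rewrite /prop_for /continuous_at (fg x Ux).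
  exact: cvg_trans (near_eq_cvg nfg).
move=> [fc fd].
have nfg x : U x -> \forall y \near x, f y = g y.
  by move=> Ux; apply: filterS (open_nbhs_nbhs (conj oU Ux)) => y; exact: fg.
split=> [x Ux|i].
  have := fc x Ux; rewrite /prop_for /continuous_at (fg x Ux).
  exact: cvg_trans (near_eq_cvg (nfg x Ux)).
have [fi fdi] := fd i.
split=> [x Ux|].
  exact: (near_eq_derivable (nfg x Ux) (fi x Ux)).
by apply: IH fdi => x Ux; exact/near_eq_derive/nfg.
Qed.

Lemma Ck_cst U k (c : R) : open U -> Ck U k (fun=> c).
Proof.
move=> oU; elim: k c => [|k IH] c.
  by split=> // x _; exact: cst_continuous.
split=> [x _|i]; first exact: cst_continuous.
split=> [x _|]; first by apply: ex_derive; exact: is_derive_cst.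
by apply: eq_Ck (IH 0) => // x _; rewrite derive_cst.
Qed.

Lemma CkD U k f g : open U -> Ck U k f -> Ck U k g ->
  Ck U k (fun x => f x + g x).
Proof.
move=> oU; elim: k f g => [|k IH] f g [fc fd] [gc gd].
  by split=> // x Ux; exact: (continuousD (fc x Ux) (gc x Ux)).
split=> [x Ux|i].
  by exact: (continuousD (fc x Ux) (gc x Ux)).
have [fi fdi] := fd i; have [gi gdi] := gd i; split=> [x Ux|].
  by apply: derivableD; [exact: fi|exact: gi].
apply: eq_Ck (IH _ _ fdi gdi) => // x Ux.
by rewrite deriveD//; [exact: fi|exact: gi].
Qed.

Lemma CkM U k f g : open U -> Ck U k f -> Ck U k g ->
  Ck U k (fun x => f x * g x).
Proof.
move=> oU; elim: k f g => [|k IH] f g Hf Hg.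
  case: Hf Hg => fc _ [gc _].
  by split=> // x Ux; exact: (continuousM (fc x Ux) (gc x Ux)).
have [f' g'] := (CkW Hf, CkW Hg).
case: Hf Hg => fc fd [gc gd].
split=> [x Ux|i].
  by exact: (continuousM (fc x Ux) (gc x Ux)).
have [fi fdi] := fd i; have [gi gdi] := gd i; split=> [x Ux|].
  by apply: derivableM; [exact: fi|exact: gi].
apply: eq_Ck (CkD oU (IH _ _ f' gdi) (IH _ _ g' fdi)) => // x Ux.
by rewrite deriveM//; [exact: fi|exact: gi].
Qed.

End SmoothEuclidean.

(* Only the restrictions of [chart_map] to [chart_dom] and of [chart_inv] to
   [chart_img] are meaningful. *)
Record chart (R : realType) (T : topologicalType) (n : nat) := Chart {
  chart_dom : set T;
  chart_img : set 'rV[R]_n;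
  chart_map :> T -> 'rV[R]_n;
  chart_inv : 'rV[R]_n -> T;
  open_chart_dom : open chart_dom;
  open_chart_img : open chart_img;
  chart_mapP : forall p, chart_dom p -> chart_img (chart_map p);
  chart_invP : forall x, chart_img x -> chart_dom (chart_inv x);
  chart_mapK : forall p, chart_dom p -> chart_inv (chart_map p) = p;
  chart_invK : forall x, chart_img x -> chart_map (chart_inv x) = x;
  chart_map_continuous :
    forall p, chart_dom p -> {for p, continuous chart_map};
  chart_inv_continuous :
    forall x, chart_img x -> {for x, continuous chart_inv}
}.

Record smooth_manifold (R : realType) := SmoothManifold {
  manifold_space :> topologicalType;
  manifold_dim : nat;
  atlas : set (chart R manifold_space manifold_dim);
  manifold_hausdorff : hausdorff_space manifold_space;
  manifold_second_countable : @second_countable manifold_space;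
  atlas_cover : forall p : manifold_space, exists2 c, atlas c & chart_dom c p;
  atlas_smooth : forall c d, atlas c -> atlas d -> forall i,
    smooth (chart_img c `&` chart_inv c @^-1` chart_dom d)
           (fun x => d (chart_inv c x) 0 i)
}.

Section SmoothFunctions.
Variables (R : realType) (M : smooth_manifold R).
Implicit Types (W V : set M) (f g : M -> R).

Definition chart_region (c : chart R M (manifold_dim M)) W :=
  chart_img c `&` chart_inv c @^-1` W.

(* Smoothness of the restriction of [f] to an open set [W]. *)
Definition smooth_on W f := forall c, atlas c ->
  smooth (chart_region c W) (f \o chart_inv c).

Lemma open_chart_region c W : open W -> open (chart_region c W).
Proof.
move=> oW; rewrite openE => x [cx Wx].
have cN : nbhs x (chart_img c).
  by apply: open_nbhs_nbhs; split=> //; exact: open_chart_img.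
have WN : nbhs (chart_inv c x) W by exact: open_nbhs_nbhs.
exact: filterI cN (chart_inv_continuous cx WN).
Qed.

Lemma smooth_on_local W f :
  (forall p, W p -> exists2 V, V p & smooth_on V f) -> smooth_on W f.
Proof.
move=> H c Ac k; apply: Ck_local => x [cx Wx].
have [V Vx Vf] := H _ Wx.
by exists (chart_region c V) => //; exact: Vf.
Qed.

Lemma sub_smooth_on W V f : V `<=` W -> smooth_on W f -> smooth_on V f.
Proof. by move=> VW Wf; apply: smooth_on_local => p /VW Wp; exists W. Qed.

Lemma eq_smooth_on W f g : open W -> (forall p, W p -> f p = g p) ->
  smooth_on W f -> smooth_on W g.
Proof.
move=> oW fg Wf c Ac k; apply: eq_Ck (Wf c Ac k).
  exact: open_chart_region.
by move=> x [_ Wx] /=; exact: fg.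
Qed.

Lemma smooth_on_cst W (r : R) : open W -> smooth_on W (fun=> r).
Proof. by move=> oW c _ k; apply: Ck_cst; exact: open_chart_region. Qed.

Lemma smooth_onD W f g : open W -> smooth_on W f -> smooth_on W g ->
  smooth_on W (fun p => f p + g p).
Proof.
move=> oW Wf Wg c Ac k.
exact: (CkD (open_chart_region oW) (Wf c Ac k) (Wg c Ac k)).
Qed.

Lemma smooth_onM W f g : open W -> smooth_on W f -> smooth_on W g ->
  smooth_on W (fun p => f p * g p).
Proof.
move=> oW Wf Wg c Ac k.
exact: (CkM (open_chart_region oW) (Wf c Ac k) (Wg c Ac k)).
Qed.

Lemma smooth_on_sum W (I : Type) (r : seq I) (F : I -> M -> R) : open W ->
  (forall i, smooth_on W (F i)) -> smooth_on W (fun p => \sum_(i <- r) F i p).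
Proof.
move=> oW WF; elim: r => [|i r IH].
  apply: eq_smooth_on (smooth_on_cst 0 oW) => // p _.
  by rewrite big_nil.
apply: eq_smooth_on (smooth_onD oW (WF i) IH) => // p _.
by rewrite big_cons.
Qed.

End SmoothFunctions.

Section Cinf.
Variables (R : realType) (M : smooth_manifold R).

Definition is_smooth : {pred M -> R} :=
  fun f => `[< smooth_on [set: M] f >].

Record Cinf := MkCinf { Cinf_fun :> M -> R; Cinf_smooth : Cinf_fun \in is_smooth }.

HB.instance Definition _ := [isSub for Cinf_fun].
HB.instance Definition _ := [Choice of Cinf by <:].

Lemma is_smoothP (f : M -> R) : reflect (smooth_on [set: M] f) (f \in is_smooth).
Proof. exact: asboolP. Qed.

Lemma is_smooth_subring : subring_closed is_smooth.
Proof.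
split=> [|f g /is_smoothP fs /is_smoothP gs|f g /is_smoothP fs /is_smoothP gs].
- by apply/is_smoothP; exact: (smooth_on_cst 1 openT).
- apply/is_smoothP.
  apply: eq_smooth_on (smooth_onD openT fs
    (smooth_onM openT (smooth_on_cst (-1) openT) gs)) => //; first exact: openT.
  by move=> p _; rewrite mulN1r.
- by apply/is_smoothP; exact: (smooth_onM openT fs gs).
Qed.

HB.instance Definition _ :=
  GRing.isSubringClosed.Build (M -> R) is_smooth is_smooth_subring.

Lemma is_smooth_scale : scaler_closed (is_smooth : {pred (M -> R^o)}).
Proof.
move=> k f /is_smoothP fs; apply/is_smoothP.
exact: (smooth_onM openT (smooth_on_cst k openT) fs).
Qed.

HB.instance Definition _ := GRing.SubChoice_isSubComPzRing.Build
  (M -> R) is_smooth Cinf (GRing.subringClosedP _).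

HB.instance Definition _ := GRing.isScaleClosed.Build R
  (M -> R^o) is_smooth is_smooth_scale.
HB.instance Definition _ := [SubZmodule_isSubLmodule of Cinf by <:].

End Cinf.

Section TangentSpace.
Variables (R : realType) (M : smooth_manifold R) (p : M).

(* T_p M as the space of derivations at p of the algebra of smooth functions. *)
Record tangent := MkTangent {
  tangent_fun :> Cinf M -> R;
  tangent_scalar : scalar tangent_fun;
  tangent_leibniz : forall f g : Cinf M,
    tangent_fun (f * g) = tangent_fun f * g p + f p * tangent_fun g
}.

Lemma tangentP (u v : tangent) : u =1 v -> u = v.
Proof.
case: u v => [u ul uL] [v vl vL] /= /funext E; subst v.
by congr MkTangent; exact: Prop_irrelevance.
Qed.

HB.instance Definition _ := gen_eqMixin tangent.
HB.instance Definition _ := gen_choiceMixin tangent.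

Program Definition tangent0 := @MkTangent (fun=> 0) _ _.
Next Obligation. by move=> k f g /=; rewrite mulr0 addr0. Qed.
Next Obligation. by move=> f g /=; rewrite mul0r mulr0 addr0. Qed.

Program Definition tangentN (u : tangent) := @MkTangent (fun f => - u f) _ _.
Next Obligation. by move=> u k f g /=; rewrite (tangent_scalar u) opprD mulrN. Qed.
Next Obligation. by move=> u f g /=; rewrite tangent_leibniz opprD mulNr mulrN. Qed.

Program Definition tangentD (u v : tangent) :=
  @MkTangent (fun f => u f + v f) _ _.
Next Obligation.
by move=> u v k f g /=; rewrite (tangent_scalar u) (tangent_scalar v) mulrDr addrACA.
Qed.
Next Obligation. by move=> u v f g /=; rewrite !tangent_leibniz mulrDl mulrDr addrACA. Qed.

Program Definition tangentZ (k : R) (u : tangent) :=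
  @MkTangent (fun f => k * u f) _ _.
Next Obligation. by move=> k u c f g /=; rewrite (tangent_scalar u) mulrDr mulrCA. Qed.
Next Obligation. by move=> k u f g /=; rewrite tangent_leibniz mulrDr mulrA mulrCA. Qed.

Fact tangent_addA : associative tangentD.
Proof. by move=> u v w; apply: tangentP => f /=; rewrite addrA. Qed.
Fact tangent_addC : commutative tangentD.
Proof. by move=> u v; apply: tangentP => f /=; rewrite addrC. Qed.
Fact tangent_add0 : left_id tangent0 tangentD.
Proof. by move=> u; apply: tangentP => f /=; rewrite add0r. Qed.
Fact tangent_addN : left_inverse tangent0 tangentN tangentD.
Proof. by move=> u; apply: tangentP => f /=; rewrite addNr. Qed.

HB.instance Definition _ := GRing.isZmodule.Build tangent
  tangent_addA tangent_addC tangent_add0 tangent_addN.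

Fact tangent_scaleA a b u : tangentZ a (tangentZ b u) = tangentZ (a * b) u.
Proof. by apply: tangentP => f /=; rewrite mulrA. Qed.
Fact tangent_scale1 : left_id 1 tangentZ.
Proof. by move=> u; apply: tangentP => f /=; rewrite mul1r. Qed.
Fact tangent_scaleDr : right_distributive tangentZ +%R.
Proof. by move=> k u v; apply: tangentP => f /=; rewrite mulrDr. Qed.
Fact tangent_scaleDl v : {morph tangentZ^~ v : a b / a + b}.
Proof. by move=> a b; apply: tangentP => f /=; rewrite mulrDl. Qed.

HB.instance Definition _ := GRing.Zmodule_isLmodule.Build R tangent
  tangent_scaleA tangent_scale1 tangent_scaleDr tangent_scaleDl.

End TangentSpace.

(* A local trivialization of the family [E] of vector spaces: over [triv_dom],
   [triv_coord p] is a linear isomorphism of [E p] onto R^r with inverse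
   [triv_vec p]; the values of both elsewhere are irrelevant. *)
Record trivialization (R : realType) (M : smooth_manifold R)
    (E : M -> lmodType R) (r : nat) := Trivialization {
  triv_dom : set M;
  triv_coord : forall p, {linear E p -> 'rV[R]_r};
  triv_vec : forall p, 'rV[R]_r -> E p;
  open_triv_dom : open triv_dom;
  triv_coordK : forall p, triv_dom p -> cancel (triv_coord p) (triv_vec p);
  triv_vecK : forall p, triv_dom p -> cancel (triv_vec p) (triv_coord p)
}.

Definition triv_frame (R : realType) (M : smooth_manifold R)
    (E : M -> lmodType R) (r : nat) (s : trivialization E r) (i : 'I_r) (p : M)
  : E p := triv_vec s p (delta_mx 0 i).

(* A vector bundle is given by its fibres and by a family of local
   trivializations covering M with smooth transition matrices. *)
Record vector_bundle (R : realType) (M : smooth_manifold R) := VectorBundle {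
  fiber :> M -> lmodType R;
  bundle_rank : nat;
  triv_atlas : set (trivialization fiber bundle_rank);
  triv_atlas_cover : forall p : M, exists2 s, triv_atlas s & triv_dom s p;
  triv_atlas_smooth : forall s s', triv_atlas s -> triv_atlas s' ->
    forall i j, smooth_on (triv_dom s `&` triv_dom s')
      (fun p => triv_coord s' p (triv_frame s i p) 0 j)
}.

Section Bundles.
Variables (R : realType) (M : smooth_manifold R).
Implicit Types A B : vector_bundle M.

Definition smooth_section A (x : forall p, A p) : Prop :=
  forall s, triv_atlas s -> forall i,
    smooth_on (triv_dom s) (fun p => triv_coord s p (x p) 0 i).

Record section A := MkSection {
  section_fun :> forall p, A p;
  section_smooth : smooth_section section_fun
}.

Definition smooth_bundle_map A B (F : forall p, A p -> B p) : Prop :=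
  forall s s', triv_atlas s -> triv_atlas s' -> forall i j,
    smooth_on (triv_dom s `&` triv_dom s')
      (fun p => triv_coord s' p (F p (triv_frame s i p)) 0 j).

(* Bundle maps over the identity of M. *)
Record bundle_map A B := MkBundleMap {
  bundle_map_fun :> forall p, {linear A p -> B p};
  bundle_map_smooth : smooth_bundle_map bundle_map_fun
}.

(* Bundle maps A -> TM over the identity of M. Smoothness is tested on the
   vector fields along the local frames of A: a field of tangent vectors on an
   open set is smooth iff it maps every smooth function on M to a smooth
   function. *)
Record anchor_map A := MkAnchor {
  anchor_fun :> forall p, {linear A p -> tangent p};
  anchor_smooth : forall s, triv_atlas s -> forall i (f : Cinf M),
    smooth_on (triv_dom s) (fun p => anchor_fun p (triv_frame s i p) f)
}.

Lemma sectionP A (x y : section A) : (forall p, x p = y p) -> x = y.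
Proof.
case: x y => [x xs] [y ys] /= xy.
have E : x = y by exact: functional_extensionality_dep.
subst y.
by congr MkSection; exact: Prop_irrelevance.
Qed.

Lemma triv_expand A (s : trivialization A (bundle_rank A)) p (u : A p) :
  triv_dom s p -> u = \sum_i triv_coord s p u 0 i *: triv_frame s i p.
Proof.
move=> sp; apply: (can_inj (triv_coordK sp)).
rewrite linear_sum [LHS]row_sum_delta; apply: eq_bigr => i _.
by rewrite linearZ /= /triv_frame triv_vecK.
Qed.

Section SectionModule.
Variable A : vector_bundle M.

HB.instance Definition _ := gen_eqMixin (section A).
HB.instance Definition _ := gen_choiceMixin (section A).

Lemma smooth_sectionD (x y : forall p, A p) : smooth_section x ->
  smooth_section y -> smooth_section (fun p => x p + y p).
Proof.
move=> xs ys s As i; have oS := open_triv_dom s.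
apply: eq_smooth_on (smooth_onD oS (xs s As i) (ys s As i)) => // p _.
by rewrite linearD mxE.
Qed.

Lemma smooth_section_mul (f : M -> R) (x : forall p, A p) :
  smooth_on [set: M] f -> smooth_section x ->
  smooth_section (fun p => f p *: x p).
Proof.
move=> fs xs s As i; have oS := open_triv_dom s.
have fS := sub_smooth_on (@subsetT _ (triv_dom s)) fs.
apply: eq_smooth_on (smooth_onM oS fS (xs s As i)) => // p _.
by rewrite linearZ mxE.
Qed.

Lemma smooth_section0 : smooth_section (fun p => 0 : A p).
Proof.
move=> s As i; have oS := open_triv_dom s.
apply: eq_smooth_on (smooth_on_cst 0 oS) => // p _.
by rewrite linear0 mxE.
Qed.

Definition section0 : section A := MkSection smooth_section0.
Definition sectionD (x y : section A) : section A :=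
  MkSection (smooth_sectionD (section_smooth x) (section_smooth y)).
Definition sectionZ (k : R) (x : section A) : section A :=
  MkSection (smooth_section_mul (smooth_on_cst k openT) (section_smooth x)).

Fact section_addA : associative sectionD.
Proof. by move=> x y z; apply: sectionP => p /=; rewrite addrA. Qed.
Fact section_addC : commutative sectionD.
Proof. by move=> x y; apply: sectionP => p /=; rewrite addrC. Qed.
Fact section_add0 : left_id section0 sectionD.
Proof. by move=> x; apply: sectionP => p /=; rewrite add0r. Qed.
Fact section_addN : left_inverse section0 (sectionZ (-1)) sectionD.
Proof. by move=> x; apply: sectionP => p /=; rewrite scaleN1r addNr. Qed.

HB.instance Definition _ := GRing.isZmodule.Build (section A)
  section_addA section_addC section_add0 section_addN.

Fact section_scaleA a b x : sectionZ a (sectionZ b x) = sectionZ (a * b) x.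
Proof. by apply: sectionP => p /=; rewrite scalerA. Qed.
Fact section_scale1 : left_id 1 sectionZ.
Proof. by move=> x; apply: sectionP => p /=; rewrite scale1r. Qed.
Fact section_scaleDr : right_distributive sectionZ +%R.
Proof. by move=> k x y; apply: sectionP => p /=; rewrite scalerDr. Qed.
Fact section_scaleDl x : {morph sectionZ^~ x : a b / a + b}.
Proof. by move=> a b; apply: sectionP => p /=; rewrite scalerDl. Qed.

HB.instance Definition _ := GRing.Zmodule_isLmodule.Build R (section A)
  section_scaleA section_scale1 section_scaleDr section_scaleDl.

Definition fmul (f : Cinf M) (x : section A) : section A :=
  MkSection (smooth_section_mul (elimT (is_smoothP f) (Cinf_smooth f))
                                (section_smooth x)).

End SectionModule.

Section MapOnSections.
Variables A B : vector_bundle M.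

Lemma smooth_map_section (F : bundle_map A B) (x : section A) :
  smooth_section (fun p => F p (x p)).
Proof.
move=> s' Bs' j; apply: smooth_on_local => p s'p.
have [s As sp] := triv_atlas_cover A p.
have oS := openI (open_triv_dom s) (open_triv_dom s').
exists (triv_dom s `&` triv_dom s') => //.
have xS i := sub_smooth_on (@subIsetl _ (triv_dom s) (triv_dom s'))
  (section_smooth x As i).
have FS i := bundle_map_smooth F As Bs' i j.
apply: eq_smooth_on (smooth_on_sum (index_enum _) oS
  (fun i => smooth_onM oS (xS i) (FS i))) => // q [sq _].
rewrite [in RHS](triv_expand (x q) sq) !linear_sum summxE.
by apply: eq_bigr => i _; rewrite !linearZ mxE.
Qed.

Definition map_section (F : bundle_map A B) (x : section A) : section B :=
  MkSection (smooth_map_section F x).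

Lemma smooth_anchor_act (a : anchor_map A) (x : section A) (f : Cinf M) :
  (fun p => a p (x p) f) \in is_smooth (M:=M).
Proof.
apply/is_smoothP; apply: smooth_on_local => p _.
have [s As sp] := triv_atlas_cover A p.
have oS := open_triv_dom s; exists (triv_dom s) => //.
apply: eq_smooth_on (smooth_on_sum (index_enum _) oS (fun i =>
  smooth_onM oS (section_smooth x As i) (anchor_smooth a As i f))) => // q sq.
rewrite [in RHS](triv_expand (x q) sq) linear_sum /=.
elim/big_ind2: _ => // [u v u' v' -> ->//|i _].
by rewrite linearZ.
Qed.

(* The smooth function a(x)(f). *)
Definition anchor_act (a : anchor_map A) (x : section A) (f : Cinf M) : Cinf M :=
  MkCinf (smooth_anchor_act a x f).

End MapOnSections.

Section Perturbations.
Variable A : vector_bundle M.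

(* a + t b *)
Program Definition anchorDZ (a : anchor_map A) (t : R) (b : anchor_map A) :
    anchor_map A :=
  @MkAnchor A (fun p => a p \+ t \*: b p) _.
Next Obligation.
move=> a t b s As i f; have oS := open_triv_dom s.
exact: (smooth_onD oS (anchor_smooth a As i f)
  (smooth_onM oS (smooth_on_cst t oS) (anchor_smooth b As i f))).
Qed.

(* Id + t N *)
Program Definition idDZ (t : R) (N : bundle_map A A) : bundle_map A A :=
  @MkBundleMap A A (fun p => idfun \+ t \*: N p) _.
Next Obligation.
move=> t N s s' As As' i j.
have oS := openI (open_triv_dom s) (open_triv_dom s').
apply: eq_smooth_on (smooth_onD oS (triv_atlas_smooth As As' i j)
  (smooth_onM oS (smooth_on_cst t oS) (bundle_map_smooth N As As' i j))) => //.
by move=> p _; rewrite /= linearD linearZ !mxE.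
Qed.

End Perturbations.
End Bundles.

Section Algebroids.
Variables (R : realType) (M : smooth_manifold R).
Implicit Types A B : vector_bundle M.

Definition left_symmetric (V : lmodType R) (mul : V -> V -> V) : Prop :=
  forall x y z, mul (mul x y) z - mul x (mul y z)
              = mul (mul y x) z - mul y (mul x z).

Definition R_bilinear (V : lmodType R) (mul : V -> V -> V) : Prop :=
  (forall y, linear (mul^~ y)) /\ (forall x, linear (mul x)).

(* A product on sections together with an anchor, without axioms. *)
Record algebroid_data A := AlgebroidData {
  amul : section A -> section A -> section A;
  anchor : anchor_map A
}.

Definition left_symmetric_algebroid A (P : algebroid_data A) : Prop :=
  [/\ R_bilinear (amul P),
      left_symmetric (amul P),
      forall x (f : Cinf M) y,
        amul P x (fmul f y)
        = fmul f (amul P x y) + fmul (anchor_act (anchor P) x f) y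
    & forall (f : Cinf M) x y, amul P (fmul f x) y = fmul f (amul P x y)].

Definition algebroid_morphism A B (P : algebroid_data A) (Q : algebroid_data B)
    (F : bundle_map A B) : Prop :=
  (forall x y, map_section F (amul P x y)
               = amul Q (map_section F x) (map_section F y)) /\
  (forall p (u : A p), anchor Q p (F p u) = anchor P p u).

(* The inverse is required to be a (smooth) bundle map; it is then
   automatically a morphism. *)
Definition algebroid_isomorphism A B (P : algebroid_data A)
    (Q : algebroid_data B) (F : bundle_map A B) : Prop :=
  algebroid_morphism P Q F /\
  exists G : bundle_map B A,
    (forall p, cancel (F p) (G p)) /\ (forall p, cancel (G p) (F p)).

Definition nijenhuis A (P : algebroid_data A) (N : bundle_map A A) : Prop :=
  forall x y, let Ns := map_section N in
    amul P (Ns x) (Ns y) - Ns (amul P x (Ns y)) - Ns (amul P (Ns x) y)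
    + Ns (Ns (amul P x y)) = 0.

Record Der2 A := MkDer2 {
  der2_fun :> section A -> section A -> section A;
  symbol : anchor_map A;
  der2_bilinear : R_bilinear der2_fun;
  der2_linear : forall (f : Cinf M) x y,
    der2_fun (fmul f x) y = fmul f (der2_fun x y);
  der2_leibniz : forall x (f : Cinf M) y,
    der2_fun x (fmul f y)
    = fmul f (der2_fun x y) + fmul (anchor_act symbol x f) y
}.

Definition d_def A (P : algebroid_data A) (N : bundle_map A A)
    (x y : section A) : section A :=
  amul P x (map_section N y) + amul P (map_section N x) y
  - map_section N (amul P x y).

Definition deformed A (P : algebroid_data A) (w : Der2 A) (t : R) :
    algebroid_data A :=
  AlgebroidData (fun x y => amul P x y + t *: w x y)
                (anchorDZ (anchor P) t (symbol w)).

(* [I] is the range of the parameter. *)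
Definition generates_deformation A (P : algebroid_data A) (w : Der2 A)
    (I : set R) : Prop :=
  forall t, I t -> left_symmetric_algebroid (deformed P w t).

Definition trivial_deformation A (P : algebroid_data A) (w : Der2 A)
    (I : set R) : Prop :=
  exists N : bundle_map A A, forall t, I t ->
    algebroid_isomorphism (deformed P w t) P (idDZ t N).

End Algebroids.

(* Main.v *)
(** The associator of the deformed product x.y + t d_def N(x,y) has, after
    antisymmetrization in its first two arguments, a coefficient of t that is a
    combination of antisymmetrized associators of the original product. The same
    holds for the coefficient of t^2 by the Nijenhuis identity, so the deformed
    product is left-symmetric for every t, even if Id + tN is not invertible.
    The Nijenhuis identity also says N(d_def N(x,y)) = N(x).N(y), which is the
    t^2 part of Id + tN being a homomorphism. The inverse of Id + tN is smooth
    because its local matrices are inverses of smooth matrices. *)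
Require Import Defs.
From HB Require Import structures.
From mathcomp Require Import all_boot all_order all_algebra.
From mathcomp Require Import all_classical all_reals all_analysis.
From mathcomp Require Import ring lra.
Set Implicit Arguments.
Unset Strict Implicit.
Unset Printing Implicit Defensive.
Import Order.TTheory GRing.Theory Num.Theory.
Import numFieldNormedType.Exports.
Local Open Scope classical_set_scope.
Local Open Scope ring_scope.

(** * Nijenhuis operators on a left-symmetric algebra *)

Section NijenhuisAlgebra.
Variables (R : realType) (V : lmodType R) (mul : V -> V -> V).
Variable N : {linear V -> V}.
Hypothesis mul_bilinear : R_bilinear mul.
(* Reduces identities in [V] to identities in [R]; for sections of a bundle the
   coordinates in local frames provide enough functionals. *)
Hypothesis scalar_separates :
  forall u v : V, (forall phi : {scalar V}, phi u = phi v) -> u = v.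

(** For N acting on sections this is convertible to [d_def], so the lemmas of this part apply there
    directly. *)
Definition nijenhuis_bracket x y := mul x (N y) + mul (N x) y - N (mul x y).
Local Notation w := nijenhuis_bracket.

Lemma bilinearDl x y z : mul (x + y) z = mul x z + mul y z.
Proof. by have := mul_bilinear.1 z 1 x y; rewrite !scale1r. Qed.
Lemma bilinearDr x y z : mul z (x + y) = mul z x + mul z y.
Proof. by have := mul_bilinear.2 z 1 x y; rewrite !scale1r. Qed.
Lemma bilinearZl k x z : mul (k *: x) z = k *: mul x z.
Proof. exact: (scalable_linear (mul_bilinear.1 z)). Qed.
Lemma bilinearZr k x z : mul z (k *: x) = k *: mul z x.
Proof. exact: (scalable_linear (mul_bilinear.2 z)). Qed.
Lemma bilinearNl x y : mul (- x) y = - mul x y.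
Proof. by rewrite -[- x]scaleN1r bilinearZl scaleN1r. Qed.
Lemma bilinearNr x y : mul y (- x) = - mul y x.
Proof. by rewrite -[- x]scaleN1r bilinearZr scaleN1r. Qed.

Let linE := (bilinearDl, bilinearDr, bilinearNl, bilinearNr, bilinearZl,
  bilinearZr, linearD N, linearN N, linearZ_LR N).
Let scalarE (phi : {scalar V}) := (linearD phi, linearN phi, linearZ_LR phi).

Lemma nijenhuis_bracket_bilinear : R_bilinear w.
Proof.
by split=> [y|x] k u v; apply: scalar_separates => phi;
  rewrite /nijenhuis_bracket !linE /= !scalarE /=; ring.
Qed.

Lemma bilinear_perturb t : R_bilinear (fun x y => mul x y + t *: w x y).
Proof.
have [wl wr] := nijenhuis_bracket_bilinear; have [ml mr] := mul_bilinear.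
split=> [y|x] k u v.
  by rewrite (ml y) (wl y) !scalerDr !scalerA mulrC addrACA.
by rewrite (mr x) (wr x) !scalerDr !scalerA mulrC addrACA.
Qed.

Hypothesis mul_left_symmetric : left_symmetric mul.
Hypothesis N_nijenhuis : forall x y,
  mul (N x) (N y) - N (mul x (N y)) - N (mul (N x) y) + N (N (mul x y)) = 0.

Lemma nijenhuis_mul x y :
  mul (N x) (N y) = N (mul x (N y)) + N (mul (N x) y) - N (N (mul x y)).
Proof.
apply: scalar_separates => phi; have /(congr1 phi) := N_nijenhuis x y.
by rewrite !scalarE linear0; lra.
Qed.

Lemma nijenhuis_morphism t x y (F := fun u => u + t *: N u) :
  F (mul x y + t *: w x y) = mul (F x) (F y).
Proof.
apply: scalar_separates => phi; rewrite /F /nijenhuis_bracket !linE /=.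
by rewrite nijenhuis_mul !scalarE /=; ring.
Qed.

Lemma left_symmetric_deformed t :
  left_symmetric (fun x y => mul x y + t *: w x y).
Proof.
have LS a b c : mul (mul a b) c =
    mul a (mul b c) + mul (mul b a) c - mul b (mul a c).
  apply: scalar_separates => phi.
  have /(congr1 phi) := mul_left_symmetric a b c.
  by rewrite !scalarE; lra.
move=> x y z; apply: scalar_separates => phi.
rewrite /nijenhuis_bracket !linE /=.
have NN a b : N (N (mul a b)) =
    N (mul a (N b)) + N (mul (N a) b) - mul (N a) (N b).
  by rewrite nijenhuis_mul opprB addrC subrK.
(* [NN] exposes the products N(a).N(b) inside the remaining ones, and
   [nijenhuis_mul] removes the products N(a.b).N(c) and N(a).N(b.c). *)
rewrite !(NN x y, NN y x, NN x z, NN y z) !linE.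
rewrite !(nijenhuis_mul (mul _ _), nijenhuis_mul _ (mul _ _)).
(* Left-nested products with x before y are traded for those with y first. The rewriting stops
   because the rules never match y first, and the terms left over cancel linearly. *)
rewrite !(LS x y, LS (N x) y, LS x (N y), LS (N x) (N y)).
by rewrite !linE !scalarE /=; ring.
Qed.

End NijenhuisAlgebra.

(** * Reciprocals of C^k functions *)

Section SmoothInverse.
Variables (R : realType) (n : nat).
Implicit Types (U : set 'rV[R]_n) (f : 'rV[R]_n -> R).

(** Induction on [k]: the partial derivatives of 1/f are -(1/f)(1/f) D_i f, which are C^k once 1/f
    is. *)
Lemma CkV U k f : open U -> (forall x, U x -> f x != 0) ->
  Ck U k f -> Ck U k (fun x => (f x)^-1).
Proof.
move=> oU fN0; elim: k => [|k IH] Hf.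
  by split=> // x Ux; apply: continuousV; [exact: fN0|case: Hf => + _; apply].
have f' := CkW Hf; case: Hf => fc fd.
split=> [x Ux|i]; first by apply: continuousV; [exact: fN0|exact: fc].
have [fi fdi] := fd i; split=> [x Ux|].
  by apply: derivableV; [exact: fN0|exact: fi].
have Hi := IH f'.
apply: eq_Ck (CkM oU (Ck_cst k (-1) oU) (CkM oU (CkM oU Hi Hi) fdi)) => // x Ux.
rewrite deriveV; [|exact: fN0|exact: fi].
by rewrite mulN1r scaleNr expr2 invfM.
Qed.

End SmoothInverse.

(** * Smooth inverses of matrices and of bundle maps *)

Section SmoothMatrices.
Variables (R : realType) (M : smooth_manifold R).
Implicit Types W : set M.

Lemma smooth_onV W (f : M -> R) : open W -> (forall p, W p -> f p != 0) ->
  smooth_on W f -> smooth_on W (fun p => (f p)^-1).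
Proof.
move=> oW fN0 Wf c Ac k; apply: CkV (Wf c Ac k); first exact: open_chart_region.
by move=> x [_ Wx]; exact: fN0.
Qed.

Lemma smooth_on_prod W (I : Type) (r : seq I) (F : I -> M -> R) : open W ->
  (forall i, smooth_on W (F i)) -> smooth_on W (fun p => \prod_(i <- r) F i p).
Proof.
move=> oW WF; elim: r => [|i r IH].
  by apply: eq_smooth_on (smooth_on_cst 1 oW) => // p _; rewrite big_nil.
by apply: eq_smooth_on (smooth_onM oW (WF i) IH) => // p _; rewrite big_cons.
Qed.

(** [\det] unfolds to the Leibniz sum over permutations, a polynomial in the entries. *)
Lemma smooth_on_det W m (F : M -> 'M[R]_m) : open W ->
  (forall i j, smooth_on W (fun p => F p i j)) ->
  smooth_on W (fun p => \det (F p)).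
Proof.
move=> oW WF; apply: smooth_on_sum => // s; apply: smooth_onM => //.
  exact: smooth_on_cst.
exact: smooth_on_prod.
Qed.

(** Cramer's rule: the entries are transposed cofactors divided by the determinant. *)
Lemma smooth_on_invmx W m (F : M -> 'M[R]_m) : open W ->
  (forall p, W p -> F p \in unitmx) ->
  (forall i j, smooth_on W (fun p => F p i j)) ->
  forall i j, smooth_on W (fun p => invmx (F p) i j).
Proof.
move=> oW Fu WF i j.
have det_neq0 p : W p -> \det (F p) != 0.
  by move=> /Fu; rewrite unitmxE unitfE.
have detVS := smooth_onV oW det_neq0 (smooth_on_det oW WF).
have cofS : smooth_on W (fun p => cofactor (F p) j i).
  apply: smooth_onM => //; first exact: smooth_on_cst.
  apply: smooth_on_det => // a b.
  by apply: eq_smooth_on (WF (lift j a) (lift i b)) => // p _; rewrite !mxE.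
apply: eq_smooth_on (smooth_onM oW detVS cofS) => // p Wp.
by rewrite /invmx (Fu p Wp) !mxE.
Qed.

Lemma smooth_bundle_map_inverse (A : vector_bundle M) (F : bundle_map A A)
    (G : forall p, {linear A p -> A p}) :
  (forall p, cancel (G p) (F p)) -> smooth_bundle_map G.
Proof.
move=> GK s s' As As' i j.
(* Rows are the coordinates of images of frame vectors, so F after G has matrix [Gm p *m Fm p]. F is
   read from [s'] to [s] and G back, and a one-sided inverse of a square matrix suffices. *)
pose Fm p := \matrix_(j, k) triv_coord s p (F p (triv_frame s' j p)) 0 k.
pose Gm p := \matrix_(i, j) triv_coord s' p (G p (triv_frame s i p)) 0 j.
have GF p : (triv_dom s `&` triv_dom s') p -> Gm p *m Fm p = 1%:M.
  move=> [sp s'p]; apply/matrixP => a b; rewrite !mxE.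
  have := GK p (triv_frame s a p).
  rewrite (triv_expand (G p _) s'p) linear_sum => /(congr1 (triv_coord s p)).
  rewrite linear_sum /= {2}/triv_frame triv_vecK // => /matrixP /(_ 0 b).
  rewrite summxE !mxE eqxx /= eq_sym => <-.
  by apply: eq_bigr => c _; rewrite !mxE !linearZ mxE.
have oW := openI (open_triv_dom s) (open_triv_dom s').
have FmS a b : smooth_on (triv_dom s `&` triv_dom s') (fun p => Fm p a b).
  rewrite setIC.
  apply: eq_smooth_on (bundle_map_smooth F As' As a b) => [|p _].
    by rewrite setIC.
  by rewrite mxE.
have Fu p : (triv_dom s `&` triv_dom s') p -> Fm p \in unitmx.
  by move=> /GF /mulmx1_unit [].
apply: eq_smooth_on (smooth_on_invmx oW Fu FmS i j) => // p Wp.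
by rewrite -[invmx _]mul1mx -(GF p Wp) mulmxK ?Fu// mxE.
Qed.

End SmoothMatrices.

(** * The deformation of the algebroid generated by N *)

Section Nijenhuis.
Variables (R : realType) (M : smooth_manifold R) (A : vector_bundle M).

(** Smoothness of an anchor is given along frame vectors, so N(e_i) is first expanded in a local
    frame. *)
Lemma anchor_comp_smooth (a : anchor_map A) (N : bundle_map A A) s :
  triv_atlas s -> forall i (f : Cinf M),
  smooth_on (triv_dom s) (fun p => a p (N p (triv_frame s i p)) f).
Proof.
move=> As i f; apply: smooth_on_local => p sp.
have [s' As' s'p] := triv_atlas_cover A p.
have oW := openI (open_triv_dom s) (open_triv_dom s').
exists (triv_dom s `&` triv_dom s') => //.
have aS j := sub_smooth_on (@subIsetr _ (triv_dom s) (triv_dom s'))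
  (anchor_smooth a As' j f).
apply: eq_smooth_on (smooth_on_sum (index_enum _) oW (fun j =>
  smooth_onM oW (bundle_map_smooth N As As' i j) (aS j))) => // q [_ s'q].
rewrite [in RHS](triv_expand (N q _) s'q) linear_sum /=.
elim/big_ind2: _ => // [u v u' v' -> ->//|j _].
by rewrite linearZ.
Qed.

Definition anchor_comp (a : anchor_map A) (N : bundle_map A A) : anchor_map A :=
  @MkAnchor R M A (fun p => a p \o N p) (anchor_comp_smooth a N).

Lemma map_section_linear (N : bundle_map A A) : linear (map_section N).
Proof. by move=> k x y; apply: sectionP => p /=; rewrite linearP. Qed.

HB.instance Definition _ (N : bundle_map A A) :=
  GRing.isLinear.Build R (section A) (section A) *:%R (map_section N)
    (map_section_linear N).

(** A linear functional at every [p], but a genuine coordinate only over [triv_dom s]. *)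
Definition coefficient (s : trivialization A (bundle_rank A)) p i
  (x : section A) : R := triv_coord s p (x p) 0 i.

Lemma coefficient_linear s p i : scalar (coefficient s p i).
Proof. by move=> k x y; rewrite /coefficient /= linearP !mxE. Qed.

HB.instance Definition _ s p i :=
  GRing.isLinear.Build R (section A) R *%R (coefficient s p i)
    (coefficient_linear s p i).

Lemma section_scalar_separates (x y : section A) :
  (forall phi : {scalar section A}, phi x = phi y) -> x = y.
Proof.
move=> xy; apply: sectionP => p.
have [s As sp] := triv_atlas_cover A p.
apply: (can_inj (triv_coordK sp)); apply/rowP => i.
exact: (xy (coefficient s p i)).
Qed.

Lemma map_section_fmul (N : bundle_map A A) f x :
  map_section N (fmul f x) = fmul f (map_section N x).
Proof. by apply: sectionP => p /=; rewrite linearZ. Qed.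

Lemma anchor_act_comp (a : anchor_map A) N x f :
  anchor_act (anchor_comp a N) x f = anchor_act a (map_section N x) f.
Proof. exact: val_inj. Qed.

Lemma map_section_idDZ t (N : bundle_map A A) x :
  map_section (idDZ t N) x = x + t *: map_section N x.
Proof. exact: sectionP. Qed.

(** Each fibrewise inverse is linear and is selected by choice; smoothness of the resulting family
    comes from the inverse matrices. *)
Lemma bijective_bundle_map_inverse (F : bundle_map A A) :
  (forall p, bijective (F p)) ->
  exists G : bundle_map A A,
    (forall p, cancel (F p) (G p)) /\ (forall p, cancel (G p) (F p)).
Proof.
move=> bijF.
have exG p : exists g : {linear A p -> A p},
    cancel (F p) g /\ cancel g (F p).
  have [g Fg gF] := bijF p.
  pose gL := GRing.isLinear.Build R (A p) (A p) *:%R g (can2_linear Fg gF).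
  pose g' : {linear A p -> A p} := HB.pack g gL.
  by exists g'.
pose G p := sval (cid (exG p)); have GF p := svalP (cid (exG p)).
exists (MkBundleMap (smooth_bundle_map_inverse (G := G) (fun p => (GF p).2))).
by split=> p; case: (GF p).
Qed.

Variable P : algebroid_data A.
Hypothesis P_algebroid : left_symmetric_algebroid P.
Variable N : bundle_map A A.

Lemma d_def_linear f x y : d_def P N (fmul f x) y = fmul f (d_def P N x y).
Proof.
have [_ _ _ Pl] := P_algebroid.
rewrite /d_def map_section_fmul !Pl map_section_fmul; apply: sectionP => p /=.
by rewrite !scalerDr !scaleN1r !scalerN.
Qed.

(** The terms a(x)(f) N(y) coming from x.N(fy) and from N(x.(fy)) cancel, which leaves a(N(x))(f) y
    and makes a composed with N the symbol. *)
Lemma d_def_leibniz x f y : d_def P N x (fmul f y) =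
  fmul f (d_def P N x y) + fmul (anchor_act (anchor_comp (anchor P) N) x f) y.
Proof.
have [_ _ Pr _] := P_algebroid.
rewrite /d_def map_section_fmul !Pr [map_section N (_ + _)]linearD.
rewrite /= !map_section_fmul anchor_act_comp.
apply: sectionP => p /=; rewrite !(scalerDr, scaleN1r, scalerN, opprD).
by rewrite [LHS](AC (2*2*2) (1*3*5*4*(2*6))) /= subrr addr0.
Qed.

Lemma d_def_bilinear : R_bilinear (d_def P N).
Proof.
have [Pb _ _ _] := P_algebroid.
exact: (nijenhuis_bracket_bilinear (map_section N) Pb section_scalar_separates).
Qed.

Definition d_def_Der2 : Der2 A :=
  MkDer2 d_def_bilinear d_def_linear d_def_leibniz.

Lemma d_def_generates I : nijenhuis P N -> generates_deformation P d_def_Der2 I.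
Proof.
move=> nijN t _; have [Pb Ps Pr Pl] := P_algebroid; split=> /=.
- exact: (bilinear_perturb (map_section N) Pb section_scalar_separates t).
- exact: (left_symmetric_deformed (N := map_section N) Pb
    section_scalar_separates).
- move=> x f y; rewrite Pr d_def_leibniz; move: (d_def P N x y) => v.
  apply: sectionP => p /=.
  by rewrite !scalerDr scalerDl !scalerA [t * f p]mulrC addrACA.
- move=> f x y; rewrite Pl d_def_linear; move: (d_def P N x y) => v.
  apply: sectionP => p /=.
  by rewrite scalerDr !scalerA [t * f p]mulrC.
Qed.

(** Bijectivity holds at t = 0; for other t it says that -1/t is not an eigenvalue of N on any
    fibre. It enters only through the smooth inverse. *)
Lemma d_def_trivial (I : set R) : nijenhuis P N ->
  (forall t, I t -> forall p : M, bijective (idDZ t N p)) ->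
  trivial_deformation P d_def_Der2 I.
Proof.
move=> nijN bijN; have [Pb _ _ _] := P_algebroid.
exists N => t It; split; last exact: bijective_bundle_map_inverse (bijN t It).
split=> [x y|p u].
  rewrite !map_section_idDZ.
  exact: (nijenhuis_morphism (N := map_section N) Pb section_scalar_separates).
(* The t-part of a(u + tN(u)) is a(N(u)), the symbol at u. *)
by rewrite /= linearD linearZ.
Qed.

End Nijenhuis.

Theorem theorem6p5 (R : realType) (M : smooth_manifold R) (A : vector_bundle M)
    (P : algebroid_data A) (hP : left_symmetric_algebroid P)
    (N : bundle_map A A) (hN : nijenhuis P N) :
  exists w : Der2 A,
    (forall x y : section A, w x y = d_def P N x y) /\
    forall I : set R,
      generates_deformation P w I /\
      ((forall t, I t -> forall p : M, bijective (idDZ t N p)) ->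
       trivial_deformation P w I).
Proof.
exists (d_def_Der2 hP N); split=> // I; split; first exact: d_def_generates.
exact: d_def_trivial.
Qed.
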